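(* Let $\mathfrak{Q}$ be a set system on $X$ and let $\mathcal{I}\subseteq\{1,\dots,|X|\}$ with $1\in\mathcal{I}$. Then $\mathfrak{Q}$ is pre-$\mathcal{I}$-ary and grounded if and only if there is a DAG $G$ on $X$ with the $\mathcal{I}$-lca-property and $\mathfrak{C}_G=\mathfrak{Q}$. Moreover, $\mathfrak{Q}$ is $\mathcal{I}$-ary and grounded if and only if there is an $\mathcal{I}$-lca-relevant DAG $G$ on $X$ with the $\mathcal{I}$-lca-property such that $\mathfrak{C}_G=\mathfrak{Q}$.
   Context: All sets are finite. A directed graph $G=(V,E)$ has a nonempty vertex set and edge set $E\subseteq (V\times V)\setminus\{(v,v)\mid v\in V\}$. A DAG is a directed graph without directed cycles. For a DAG $G$, write $v\preceq_G w$ if there is a directed path (possibly of length $0$) from $w$ to $v$; then $w$ is an ancestor of $v$. $L(G)$ denotes the set of leaves (vertices with no outgoing edges); $G$ is a DAG on $X$ if $L(G)=X$. Clusters: $\mathtt{C}_G(v)=\{x\in L(G)\mid x\preceq_G v\}$ and $\mathfrak{C}_G=\{\mathtt{C}_G(v)\mid v\in V(G)\}$. For $\emptyset\neq A\subseteq L(G)$, $\mathrm{LCA}_G(A)$ is the set of $\preceq_G$-minimal vertices among those that are ancestors of all elements of $A$. If $\mathrm{LCA}_G(A)=\{v\}$, write $\mathrm{lca}_G(A)=v$ and say $\mathrm{lca}_G(A)$ is well-defined. $X(\mathcal{I})$ is the set of all $A\subseteq X$ with $|A|\in\mathcal{I}$. A DAG $G$ on $X$ is $\mathcal{I}$-lca-relevant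 if for every vertex $v$ of $G$ there is some $A\in X(\mathcal{I})$ with $v=\mathrm{lca}_G(A)$. $G$ has the $\mathcal{I}$-lca-property if $\mathrm{lca}_G(A)$ is well-defined for all $A\in X(\mathcal{I})$. A set system on $X$ is a collection of subsets of $X$. It is grounded if it contains $\{x\}$ for every $x\in X$ and does not contain $\emptyset$. A set system $\mathfrak{C}$ on $X$ is pre-$\mathcal{I}$-ary if for all $A\in X(\mathcal{I})$ there is a unique inclusion-minimal $C\in\mathfrak{C}$ with $A\subseteq C$. It is $\mathcal{I}$-ary if it is pre-$\mathcal{I}$-ary and for every $C\in\mathfrak{C}$ there is some $A\in X(\mathcal{I})$ such that $C$ is the unique inclusion-minimal element of $\mathfrak{C}$ with $A\subseteq C$. *)

(* Defs.v *)
From mathcomp Require Import all_boot.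

Set Implicit Arguments.
Unset Strict Implicit.
Unset Printing Implicit Defensive.

Record digraph := Digraph {
  vertex :> finType;
  edge : rel vertex;
  vertex_nonempty : 0 < #|vertex|;
  edge_irrefl : irreflexive edge
}.

(* [cycle] is the closed-walk predicate of path.v; the empty sequence is its
   only degenerate instance, since edges are irreflexive. *)
Definition acyclic (G : digraph) : Prop :=
  forall c : seq G, cycle (@edge G) c -> c = [::].

Section Digraphs.
Variable G : digraph.
Implicit Types (v w : G) (A : {set G}).

(* [w] is an ancestor of [v] *)
Definition preceq v w : bool := connect (@edge G) w v.

Definition leaves : {set G} := [set v | [forall w, ~~ edge v w]].

Definition cluster v : {set G} := [set x in leaves | preceq x v].

Definition clusters : {set {set G}} := [set cluster v | v : G].

Definition common_ancestors A : {set G} :=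
  [set v | [forall x in A, preceq x v]].

(* Meant for nonempty sets [A] of leaves. *)
Definition LCA A : {set G} :=
  [set v in common_ancestors A
     | [forall w in common_ancestors A, preceq w v ==> (w == v)]].

Definition is_lca A v : Prop := LCA A = [set v].

Definition lca_well_defined A : Prop := exists v, is_lca A v.

(* In the next two definitions [A] ranges over X(I) for X = L(G). *)
Definition lca_relevant (I : {pred nat}) : Prop :=
  forall v, exists A, [/\ A \subset leaves, #|A| \in I & is_lca A v].

Definition lca_property (I : {pred nat}) : Prop :=
  forall A, A \subset leaves -> #|A| \in I -> lca_well_defined A.

End Digraphs.

(* As [X] and the vertices live in different types, L(G) = X is rendered by an
   injection of [X] into the vertices of G whose image is L(G). *)
Record dag_on (X : finType) := DagOn {
  dag_graph :> digraph;
  dag_acyclic : acyclic dag_graph;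
  leaf_of : X -> dag_graph;
  leaf_of_inj : injective leaf_of;
  leaf_of_onto : leaf_of @: [set: X] = leaves dag_graph
}.
Arguments leaf_of {X} d.

Section SetSystems.
Variable X : finType.
Implicit Types (Q : {set {set X}}) (A C : {set X}).

(* The clusters of G are the members of [Q], under the identification of [X]
   with L(G). *)
Definition has_clusters (G : dag_on X) Q : Prop :=
  clusters G = [set leaf_of G @: C | C : {set X} in Q].

Definition grounded Q : Prop :=
  (forall x : X, [set x] \in Q) /\ set0 \notin Q.

Definition minimal_supersets Q A : {set {set X}} :=
  [set C | minset (fun B : {set X} => (B \in Q) && (A \subset B)) C].

Definition is_unique_minimal Q A C : Prop := minimal_supersets Q A = [set C].

Definition pre_ary (I : {pred nat}) Q : Prop :=
  forall A, #|A| \in I -> exists C, is_unique_minimal Q A C.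

Definition ary (I : {pred nat}) Q : Prop :=
  pre_ary I Q /\
  forall C, C \in Q -> exists A, #|A| \in I /\ is_unique_minimal Q A C.

End SetSystems.

(* Main.v *)
Require Import Defs.
From mathcomp Require Import all_boot.

(** Forward direction: take the DAG on [Q] itself, with an edge [C -> D]
    whenever [D] is a proper subset of [C]; its leaves are the singletons, its
    ancestor relation is inclusion, so least common ancestors are inclusion-minimal
    supersets. Backward direction: in a DAG, [v = lca(A)] exactly when [v] lies below
    every common ancestor of [A], and then the cluster of [v] is contained in every
    cluster that contains [A]. *)

Set Implicit Arguments.
Unset Strict Implicit.
Unset Printing Implicit Defensive.

(** * Ancestor order, least common ancestors and clusters in an acyclic digraph *)

Section AcyclicDigraphs.
Variable G : digraph.
Hypothesis G_acyclic : acyclic G.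
Implicit Types (u v w : G) (A : {set G}).

Lemma preceq_refl v : preceq v v.
Proof. exact: connect0. Qed.

Lemma preceq_trans u v w : preceq u v -> preceq v w -> preceq u w.
Proof. by move=> uv vw; apply: connect_trans vw uv. Qed.

Lemma preceq_anti v w : preceq v w -> preceq w v -> v = w.
Proof.
case/connectP=> p wp vE /connectP[q vq wE].
have : path (@edge G) w (p ++ q) by rewrite cat_path wp -vE.
have : last w (p ++ q) = w by rewrite last_cat -vE -wE.
(* [p ++ q] is a closed walk at [w]. If it is empty, so is [p], and [v = w]; otherwise its last
   vertex is [w], and [w :: s] is a nonempty cycle. *)
case/lastP pq: (p ++ q) => [|s z].
  by case: p pq {wp} vE => [|? ?] /=.
by rewrite last_rcons => -> /(G_acyclic (c := w :: s)).
Qed.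

(** Among the elements of [A] below [w], take one whose down-set has the fewest vertices: an element
    of [A] below it has the same down-set, hence equals it by antisymmetry. *)
Lemma preceq_min_exists A w : w \in A ->
  exists v, [/\ v \in A, preceq v w
              & forall u, u \in A -> preceq u v -> u = v].
Proof.
move=> wA; pose below v := [set u | preceq u v].
have w_ok : (w \in A) && preceq w w by rewrite wA preceq_refl.
case: (@arg_minnP _ w (fun v => (v \in A) && preceq v w)
         (fun v => #|below v|) w_ok) => v /andP[vA vw] v_min.
exists v; split=> // u uA uv; apply: preceq_anti => //.
have sub : below u \subset below v.
  by apply/subsetP=> t; rewrite !inE => /preceq_trans; apply.
have /eqP belowE : below u == below v.
  by rewrite eqEcard sub v_min // uA (preceq_trans uv vw).
have : v \in below v by rewrite inE preceq_refl.
by rewrite -belowE inE.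
Qed.

Lemma common_ancestorsP A v :
  reflect (forall x, x \in A -> preceq x v) (v \in common_ancestors A).
Proof. by rewrite inE; apply: forall_inP. Qed.

(** By finiteness every common ancestor has a minimal one below it. If [v] is the only minimal one,
    it therefore lies below all of them; the converse is antisymmetry. *)
Lemma is_lcaP A v :
  is_lca A v <-> v \in common_ancestors A /\
                 forall w, w \in common_ancestors A -> preceq v w.
Proof.
split=> [lcaE | [vA v_le]].
  split=> [|w wA].
    by have := set11 v; rewrite -lcaE => /setIdP[].
  have [u [uA uw u_min]] := preceq_min_exists wA.
  suff: u \in LCA A by rewrite lcaE => /set1P <-.
  rewrite inE uA; apply/forall_inP=> t tA.
  by apply/implyP=> /(u_min _ tA) ->.
apply/setP=> u; rewrite in_set1 inE.
apply/andP/eqP=> [[u_anc /forall_inP u_min] | ->].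
  by apply/esym/eqP; have /implyP := u_min _ vA; apply; apply: v_le.
by split=> //; apply/forall_inP=> w /v_le vw; apply/implyP=> /preceq_anti ->.
Qed.

Lemma leaf_preceq x v : x \in leaves G -> preceq v x -> v = x.
Proof.
rewrite inE => /forallP x_leaf /connectP[[|y p] //= /andP[xy _]].
by have := x_leaf y; rewrite xy.
Qed.

Lemma cluster_leaf x : x \in leaves G -> cluster x = [set x].
Proof.
move=> xL; apply/setP=> y; rewrite in_set1 inE.
apply/andP/eqP=> [[_ /(leaf_preceq xL)] // | ->].
by rewrite xL preceq_refl.
Qed.

(** A minimal vertex below [v] is a leaf: an edge from it would lead to a vertex below it, thus be a
    loop. *)
Lemma cluster_neq0 v : cluster v != set0.
Proof.
have [u [_ uv u_min]] := preceq_min_exists (in_setT v).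
apply/set0Pn; exists u; rewrite inE uv andbT inE; apply/forallP=> t.
apply/negP=> ut; have := u_min t (in_setT t) (connect1 ut).
by move=> tu; rewrite tu edge_irrefl in ut.
Qed.

Lemma clusterS v w : preceq v w -> cluster v \subset cluster w.
Proof.
by move=> vw; apply/subsetP=> x; rewrite !inE => /andP[-> /preceq_trans]; apply.
Qed.

(** The bridge between the two sides of the theorem: it turns common ancestors of leaves into
    supersets among the clusters. *)
Lemma sub_cluster A v : A \subset leaves G ->
  (A \subset cluster v) = (v \in common_ancestors A).
Proof.
move=> AL; apply/subsetP/common_ancestorsP=> [Av x /Av | Av x xA].
  by rewrite inE => /andP[].
by rewrite inE (subsetP AL) ?Av.
Qed.

End AcyclicDigraphs.

(** * A unique minimal superset is a least superset *)

Section UniqueMinimal.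
Variable X : finType.
Implicit Types (Q : {set {set X}}) (A C : {set X}).

(** The counterpart of [is_lcaP] for inclusion: below any superset [D] in [Q] there is a minimal
    one, which can only be [C]. *)
Lemma is_unique_minimalP Q A C :
  is_unique_minimal Q A C <->
  [/\ C \in Q, A \subset C & forall D, D \in Q -> A \subset D -> C \subset D].
Proof.
split=> [minE | [CQ AC C_least]].
  have : C \in minimal_supersets Q A by rewrite minE set11.
  rewrite inE => /minsetP[/andP[CQ AC] _]; split=> // D DQ AD.
  have [|B B_min BD] := @minset_exists _ (fun B => (B \in Q) && (A \subset B)) D.
    by rewrite DQ.
  suff: B \in minimal_supersets Q A by rewrite minE => /set1P <-.
  by rewrite inE.
apply/setP=> D; rewrite !inE; apply/minsetP/eqP=> [[/andP[DQ AD] D_min] | ->].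
  by apply/esym/D_min; rewrite ?CQ // C_least.
split=> [|B /andP[BQ AB] BC]; first by rewrite CQ.
by apply/eqP; rewrite eqEsubset BC C_least.
Qed.

End UniqueMinimal.

(** * From a DAG to its set system of clusters *)

Section ClustersOfDag.
Variables (X : finType) (G : dag_on X) (Q : {set {set X}}).
Hypothesis GQ : has_clusters G Q.
Implicit Types (A C : {set X}) (v : G).

Let f_inj : injective (leaf_of G) := @leaf_of_inj X G.

Lemma leaf_of_sub A : leaf_of G @: A \subset leaves G.
Proof. by rewrite -leaf_of_onto imsetS ?subsetT. Qed.

(** Transports a set of leaves back to a subset of [X]; [card_imset] then keeps its size, so
    membership in [I] is preserved. *)
Lemma leaf_setE (B : {set G}) : B \subset leaves G ->
  B = leaf_of G @: (leaf_of G @^-1: B).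
Proof.
move=> BL; apply/setP=> y; apply/idP/imsetP=> [yB | [x xB ->]].
  have := subsetP BL _ yB; rewrite -leaf_of_onto => /imsetP[x _ yE].
  by exists x; rewrite // inE -yE.
by rewrite inE in xB.
Qed.

Lemma cluster_has_clusters v : exists2 C, C \in Q & cluster v = leaf_of G @: C.
Proof.
have : cluster v \in clusters G by apply: imset_f.
by rewrite GQ => /imsetP[C CQ vC]; exists C.
Qed.

Lemma has_clusters_cluster C : C \in Q -> exists v, cluster v = leaf_of G @: C.
Proof.
move=> CQ; have : leaf_of G @: C \in clusters G by rewrite GQ imset_f.
by case/imsetP=> v _ ->; exists v.
Qed.

Lemma imset_leaf_sub A C : (leaf_of G @: A \subset leaf_of G @: C) = (A \subset C).
Proof.
apply/idP/idP=> [/subsetP AC | ]; last exact: imsetS.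
by apply/subsetP=> x xA; rewrite -(mem_imset _ _ f_inj) AC ?imset_f.
Qed.

(** Singletons arise as the clusters of leaves, and no cluster is empty. *)
Lemma has_clusters_grounded : grounded Q.
Proof.
split=> [x|].
  have [C CQ] := cluster_has_clusters (leaf_of G x).
  rewrite cluster_leaf ?(subsetP (leaf_of_sub setT)) ?imset_f //.
  by rewrite -imset_set1 => /(imset_inj f_inj) ->.
apply/negP=> /has_clusters_cluster[v]; rewrite imset0 => v0.
by have := cluster_neq0 (@dag_acyclic X G) v; rewrite v0 eqxx.
Qed.

Lemma lca_unique_minimal A C v :
  is_lca (leaf_of G @: A) v -> cluster v = leaf_of G @: C ->
  is_unique_minimal Q A C.
Proof.
move=> /(is_lcaP (@dag_acyclic X G))[vA v_least] vC.
apply/is_unique_minimalP; split.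
- have [D DQ] := cluster_has_clusters v.
  by rewrite vC => /(imset_inj f_inj) ->.
- by rewrite -imset_leaf_sub -vC sub_cluster ?leaf_of_sub.
(* A competitor [D] is the cluster of some [w], which is then a common ancestor of [A]; so [v] lies
   below [w], and clusters grow along the order. *)
- move=> D /has_clusters_cluster[w wD] AD.
  rewrite -imset_leaf_sub -vC -wD clusterS // v_least //.
  by rewrite -sub_cluster ?leaf_of_sub // wD imset_leaf_sub.
Qed.

Lemma lca_property_pre_ary (I : {pred nat}) : lca_property G I -> pre_ary I Q.
Proof.
move=> G_lca A AI.
have [|v vA] := G_lca _ (leaf_of_sub A); first by rewrite card_imset.
have [C _ vC] := cluster_has_clusters v.
by exists C; apply: lca_unique_minimal vA vC.
Qed.

Lemma lca_relevant_ary (I : {pred nat}) C : lca_relevant G I -> C \in Q ->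
  exists A, #|A| \in I /\ is_unique_minimal Q A C.
Proof.
move=> G_rel /has_clusters_cluster[v vC].
have [B [BL BI vB]] := G_rel v.
have BE := leaf_setE BL; rewrite BE in vB BI.
exists (leaf_of G @^-1: B); split; last exact: lca_unique_minimal vB vC.
by rewrite card_imset in BI.
Qed.

End ClustersOfDag.

(** * From a grounded set system to its inclusion DAG *)

Section InclusionDag.
Variables (X : finType) (x0 : X) (Q : {set {set X}}).
Hypothesis Q_grounded : grounded Q.

Definition member : finType := {C : {set X} | C \in Q}.

Implicit Types (C D : member) (A : {set X}).

Definition inclusion_edge : rel member := fun C D => val D \proper val C.

Definition singleton_member (x : X) : member :=
  Sub [set x] (Q_grounded.1 x).

Lemma member_nonempty : 0 < #|member|.
Proof. by apply/card_gt0P; exists (singleton_member x0). Qed.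

Lemma inclusion_edge_irrefl : irreflexive inclusion_edge.
Proof. by move=> C; rewrite /inclusion_edge properxx. Qed.

Definition inclusion_digraph : digraph :=
  Digraph member_nonempty inclusion_edge_irrefl.

Lemma inclusion_edge_trans : transitive inclusion_edge.
Proof. by move=> D C E DC ED; apply: proper_trans ED DC. Qed.

(** Since the edge relation is transitive, the first vertex of a cycle would have an edge to
    itself. *)
Lemma inclusion_acyclic : acyclic inclusion_digraph.
Proof.
case=> [//|C s] /= /(order_path_min inclusion_edge_trans).
by rewrite all_rcons inclusion_edge_irrefl.
Qed.

(** Inclusions compose along a path; conversely a proper inclusion is already a single edge. *)
Lemma inclusion_preceq (C D : inclusion_digraph) :
  preceq C D = (val C \subset val D).
Proof.
apply/idP/idP=> [/connectP[p] | CD].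
  elim: p D => [|E p IHp] D /= => [_ -> // | /andP[DE Ep] CE].
  exact: subset_trans (IHp _ Ep CE) (proper_sub DE).
have [-> | neq] := eqVneq C D; first exact: preceq_refl.
by apply: connect1; rewrite /= /inclusion_edge properEneq CD andbT.
Qed.

Lemma singleton_member_inj : injective singleton_member.
Proof. by move=> x y /(congr1 val) /set1_inj. Qed.

(** Both halves of groundedness enter: a proper subset of a singleton is empty, hence not in [Q],
    and a member containing [x] has an edge to the singleton of [x] unless it equals it. *)
Lemma singleton_member_onto :
  singleton_member @: [set: X] = leaves inclusion_digraph.
Proof.
apply/setP=> C; rewrite inE; apply/imsetP/forallP=> [[x _ ->] D | C_leaf].
  rewrite /= /inclusion_edge /= properE sub1set subset1 negb_and negbK -implybE.
  apply/implyP=> /orP[/eqP-> | /eqP D0]; first exact: set11.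
  by have /= := valP D; rewrite D0 (negPf Q_grounded.2).
have [C0 | [x xC]] := set_0Vmem (val C).
  by have /= := valP C; rewrite C0 (negPf Q_grounded.2).
exists x => //; apply/val_inj/eqP; have := C_leaf (singleton_member x).
by rewrite /= /inclusion_edge properEneq /= sub1set xC andbT negbK eq_sym.
Qed.

Definition inclusion_dag : dag_on X :=
  DagOn inclusion_acyclic singleton_member_inj singleton_member_onto.

Lemma inclusion_cluster (C : inclusion_dag) :
  cluster C = leaf_of inclusion_dag @: val C.
Proof.
apply/setP=> D; rewrite inE -leaf_of_onto inclusion_preceq.
apply/andP/imsetP=> [[/imsetP[x _ ->]] | [x xC ->]].
  by rewrite /= sub1set => xC; exists x.
by rewrite imset_f //= sub1set.
Qed.

Lemma inclusion_has_clusters : has_clusters inclusion_dag Q.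
Proof.
apply/setP=> B; apply/imsetP/imsetP=> [[C _ ->] | [C CQ ->]].
  by exists (val C); [apply: valP | apply: inclusion_cluster].
by exists (Sub C CQ : member); rewrite // inclusion_cluster.
Qed.

Lemma inclusion_common_ancestors A (C : inclusion_dag) :
  (C \in common_ancestors (leaf_of inclusion_dag @: A)) = (A \subset val C).
Proof.
by rewrite -sub_cluster ?leaf_of_sub // inclusion_cluster imset_leaf_sub.
Qed.

Lemma unique_minimal_is_lca A (C : inclusion_dag) :
  is_unique_minimal Q A (val C) -> is_lca (leaf_of inclusion_dag @: A) C.
Proof.
move=> /is_unique_minimalP[_ AC C_least]; apply/(is_lcaP inclusion_acyclic).
split=> [|D]; rewrite inclusion_common_ancestors // inclusion_preceq.
by apply: C_least; apply: valP.
Qed.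

Lemma inclusion_lca_property (I : {pred nat}) :
  pre_ary I Q -> lca_property inclusion_dag I.
Proof.
move=> Q_pre B BL; rewrite (leaf_setE BL) card_imset; last exact: leaf_of_inj.
move=> /Q_pre[C C_min]; have [CQ _ _] := (is_unique_minimalP _ _ _).1 C_min.
by exists (Sub C CQ : member); apply: unique_minimal_is_lca.
Qed.

Lemma inclusion_lca_relevant (I : {pred nat}) :
  ary I Q -> lca_relevant inclusion_dag I.
Proof.
move=> [_ Q_ary] C; have [A [AI C_min]] := Q_ary _ (valP C).
exists (leaf_of inclusion_dag @: A); split; first exact: leaf_of_sub.
  by rewrite card_imset //; apply: leaf_of_inj.
exact: unique_minimal_is_lca.
Qed.

End InclusionDag.

Theorem theorem3p7 (X : finType) (Q : {set {set X}}) (I : {pred nat})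
    (I_range : forall k : nat, k \in I -> 1 <= k <= #|X|)
    (I_1 : 1 \in I) :
  ((pre_ary I Q /\ grounded Q) <->
   (exists G : dag_on X, lca_property G I /\ has_clusters G Q))
  /\
  ((ary I Q /\ grounded Q) <->
   (exists G : dag_on X,
      [/\ lca_relevant G I, lca_property G I & has_clusters G Q])).
Proof.
(* As [1] lies in [I], [X] has a point; it makes the vertex set of the inclusion DAG nonempty. *)
have /andP[_ /card_gt0P[x0 _]] := I_range _ I_1.
split; split.
- move=> [Q_pre Q_gr]; exists (inclusion_dag x0 Q_gr); split.
    exact: inclusion_lca_property.
  exact: inclusion_has_clusters.
- move=> [G [G_lca GQ]]; split; last exact: has_clusters_grounded GQ.
  exact: lca_property_pre_ary GQ _ G_lca.
- move=> [Q_ary Q_gr]; exists (inclusion_dag x0 Q_gr); split.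
  + exact: inclusion_lca_relevant.
  + by apply: inclusion_lca_property; case: Q_ary.
  + exact: inclusion_has_clusters.
- move=> [G [G_rel G_lca GQ]]; split; last exact: has_clusters_grounded GQ.
  split; first exact: lca_property_pre_ary GQ _ G_lca.
  by move=> C; apply: lca_relevant_ary GQ _ _ G_rel.
Qed.
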